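(* Let $N=\{p_1,\dots,p_k\}$ be a set of $k\geq 2$ distinct points in a Minkowski space $\mathbb{M}^n$, and let $p_0\in\mathbb{M}^n\setminus N$. Then the following are equivalent: (1) the star joining $p_0$ to each $p_i$, $i\in[k]$, is an SMT of $N$; (2) $o\in\langle\Sigma\rangle$ for each parenthesization $\langle\Sigma\rangle$ (with respect to the reduced Minkowski sum $\boxplus$) of the family $\Sigma=\{\partial(p_i-p_0):i\in[k]\}$; (3) $o\in\langle\Sigma'\rangle+\partial(p_k-p_0)$ for each parenthesization $\langle\Sigma'\rangle$ (with respect to $\boxplus$) of the family $\Sigma'=\{\partial(p_i-p_0):i\in[k-1]\}$, where $+$ is the ordinary Minkowski sum of sets. Here $o$ denotes the zero functional.
   Context: $[k]=\{1,\dots,k\}$. A Minkowski space $\mathbb{M}^n$ is an $n$-dimensional real normed space $(\mathbb{R}^n,\|\cdot\|)$. A Steiner tree of a finite set $N\subset\mathbb{M}^n$ is a finite tree $T$ whose vertex set $V(T)$ is a finite set of points of $\mathbb{M}^n$ with $N\subseteq V(T)$; its length is $\ell(T)=\sum_{xy\in E(T)}\|x-y\|$. A Steiner minimal tree (SMT) of $N$ is a Steiner tree of $N$ of minimum length. The star joining $p_0$ to the points $p_1,\dots,p_k$ is the tree with vertices $p_0,p_1,\dots,p_k$ and edges $p_0p_i$, $i\in[k]$ (so $p_0$ is a Steiner point of this tree). The dual space $(\mathbb{M}^n)^*$ is the space of linear functionals with norm $\|\varphi\|^*=\max\{\varphi(x):\|x\|=1\}$, and $B^*$ is its closed unit ball.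 For non-zero $x\in\mathbb{M}^n$, $\partial x=\{\varphi:\|\varphi\|^*=1,\ \varphi(x)=\|x\|\}$ is the set of norming functionals of $x$. Reduced Minkowski sum: for closed convex subsets $C,D\subseteq B^*$, $C\boxplus D=\{\varphi+\psi:\varphi\in C,\psi\in D,\ \|\varphi+\psi\|^*\leq 1\}=(C+D)\cap B^*$ (so $C\boxplus D=\emptyset$ if $C$ or $D$ is empty). This operation is commutative but not associative. Parenthesizations: for a finite non-empty indexed family $\Sigma=\{A_i:i\in I\}$ of closed convex subsets of $B^*$, the parenthesizations $\langle\Sigma\rangle$ of $\Sigma$ are defined recursively: if $\Sigma=\{A_i\}$ is a singleton family, the only parenthesization is $\langle\Sigma\rangle=A_i$; if $\Sigma$ is the disjoint union of non-empty subfamilies $\Sigma_1,\Sigma_2$ with parenthesizations $\langle\Sigma_1\rangle,\langle\Sigma_2\rangle$, then $(\langle\Sigma_1\rangle\boxplus\langle\Sigma_2\rangle)$ is a parenthesization of $\Sigma$. Every parenthesization arises in this way (each member of the indexed family is used exactly once, in any order, with any bracketing), and is identified with the set it evaluates to. *)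

(* Defs.v *)
From mathcomp Require Import all_boot all_order all_algebra finmap.
From mathcomp Require Import boolp classical_sets reals.

Set Implicit Arguments.
Unset Strict Implicit.
Unset Printing Implicit Defensive.

Import Order.TTheory GRing.Theory Num.Theory.

Local Open Scope classical_set_scope.
Local Open Scope ring_scope.

(* A Minkowski space is ['rV[R]_n] together with an arbitrary norm [nrm]; the
   built-in [`|x|] on ['rV[R]_n] is the sup norm and is never used here. *)
Record is_norm (R : realType) (n : nat) (nrm : 'rV[R]_n -> R) : Prop := IsNorm {
  is_norm_triangle : forall x y, nrm (x + y) <= nrm x + nrm y ;
  is_norm_homogeneous : forall (a : R) x, nrm (a *: x) = `|a| * nrm x ;
  is_norm_definite : forall x, nrm x = 0 -> x = 0 }.

(* 'Hom is the space of linear maps of vector.v, so 0 is the zero functional *)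
Notation dual R n := 'Hom('rV[R]_n, R^o).

Section DualSpace.
Variables (R : realType) (n : nat) (nrm : 'rV[R]_n -> R).

(* The supremum is a maximum when [nrm] is a norm and 0 < n, by compactness of
   the unit sphere; for n = 0 the sphere is empty and the value is 0. *)
Definition dual_norm (phi : dual R n) : R :=
  sup [set phi x | x in [set x | nrm x = 1]].

Definition norming (x : 'rV[R]_n) : set (dual R n) :=
  [set phi | dual_norm phi = 1 /\ phi x = nrm x].

Definition minkowski_sum (C D : set (dual R n)) : set (dual R n) :=
  [set phi + psi | phi in C & psi in D].

Definition reduced_sum (C D : set (dual R n)) : set (dual R n) :=
  minkowski_sum C D `&` [set chi | dual_norm chi <= 1].

(* [parenthesization A S C]: the set [C] is the value of some parenthesization
   of the indexed subfamily (A i)_{i in S}.  The subfamilies are automatically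
   non-empty. *)
Inductive parenthesization (I : finType) (A : I -> set (dual R n)) :
    {set I} -> set (dual R n) -> Prop :=
| ParSingle (i : I) : parenthesization A [set i]%SET (A i)
| ParSum (S1 S2 : {set I}) (C1 C2 : set (dual R n)) :
    (S1 :&: S2)%SET = finset.set0 ->
    parenthesization A S1 C1 -> parenthesization A S2 C2 ->
    parenthesization A (S1 :|: S2)%SET (reduced_sum C1 C2).

End DualSpace.

Record graph (P : choiceType) := Graph {
  verts : {fset P} ;
  edge : rel P }.

Definition is_simple (P : choiceType) (G : graph P) : Prop :=
  [/\ symmetric (edge G), irreflexive (edge G) &
      forall x y, edge G x y -> (x \in verts G) && (y \in verts G)].

Definition is_connected (P : choiceType) (G : graph P) : Prop :=
  forall x y, x \in verts G -> y \in verts G ->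
    exists2 s : seq P, path (edge G) x s & last x s = y.

(* [path.v] cycles may have length 2, going back and forth along one edge. *)
Definition is_acyclic (P : choiceType) (G : graph P) : Prop :=
  forall c : seq P, ucycle (edge G) c -> (size c <= 2)%N.

Definition is_tree (P : choiceType) (G : graph P) : Prop :=
  [/\ is_simple G, verts G != fset0, is_connected G & is_acyclic G].

Definition star (P : choiceType) (p0 : P) (N : {fset P}) : graph P :=
  Graph (p0 |` N)%fset
    (fun x y => (x == p0) && (y \in N) || (x \in N) && (y == p0)).

Section SteinerTrees.
Variables (R : realType) (n : nat) (nrm : 'rV[R]_n -> R).

(* Each edge is counted twice in the double sum, once in each direction. *)
Definition tree_length (T : graph 'rV[R]_n) : R :=
  2^-1 * \sum_(x <- verts T) \sum_(y <- verts T | edge T x y) nrm (x - y).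

Definition is_Steiner_tree (N : {fset 'rV[R]_n}) (T : graph 'rV[R]_n) : Prop :=
  is_tree T /\ (N `<=` verts T)%fset.

Definition is_SMT (N : {fset 'rV[R]_n}) (T : graph 'rV[R]_n) : Prop :=
  is_Steiner_tree N T /\
  forall T' : graph 'rV[R]_n,
    is_Steiner_tree N T' -> tree_length T <= tree_length T'.

End SteinerTrees.

(* Main.v *)
Require Import Defs.
From HB Require Import structures.
From mathcomp Require Import all_boot all_order all_algebra finmap.
From mathcomp Require Import boolp classical_sets reals.
From mathcomp Require Import ring lra.

Set Implicit Arguments.
Unset Strict Implicit.
Unset Printing Implicit Defensive.

Import Order.TTheory GRing.Theory Num.Theory.

Local Open Scope classical_set_scope.
Local Open Scope ring_scope.

(* Write [u_i = p_i - p0], and take p0 = 0 for simplicity.  A rooted tree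
   prescribes a bracketing [C] of the terminals in each of its subtrees, and
   since members of a reduced sum have dual norm at most 1, by induction each
   [psi] in [C] satisfies [sum ||u_i|| <= psi x + (length of the subtree)], where
   [x] is the root of the subtree and the sum is over its terminals.
   Rooting a Steiner tree at p_k and using (3) bounds its length below by that
   of the star, so (3) implies (1); (2) implies (3) trivially.

   For (1) implies (2), a bracketing is turned into trees close to the star by
   choosing a position for the Steiner point of each bracket.  The first-order
   increase in length is a sublinear function [q] defined along the bracketing:
   [q] is the directional derivative of the norm at [u_i] for a single term, and
   [q x = inf_y (q1 y + q2 y + ||x - y||)] for a reduced sum.  By Hahn-Banach a
   functional below [q] lies in the value of the bracketing, and minimality of
   the star says that the zero functional is below [q].  Sublinear functions are
   represented by subsets of their epigraphs, because the infima may be -oo. *)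

(** * Sublinear functions and Hahn-Banach extension steps *)

Section SublinearEpigraphs.
Variables (R : realType) (V : lmodType R).
Implicit Types (E : V -> R -> Prop) (x y : V) (a b c : R).

(* Epigraphs of sublinear functions, not necessarily closed or upward closed. *)
Record sublinear_epigraph E : Prop := SublinearEpigraph {
  epi_total : forall x, exists c, E x c ;
  epi_add : forall x y c d, E x c -> E y d -> E (x + y) (c + d) ;
  epi_scale : forall a x c, 0 <= a -> E x c -> E (a *: x) (a * c) }.

Lemma epi0 E : sublinear_epigraph E -> E 0 0.
Proof.
by move=> hE; have [c /(epi_scale hE (lexx 0))] := epi_total hE 0; rewrite scale0r mul0r.
Qed.

(** Forces every functional below [E] to take the value [a] at [x]. *)
Definition epi_lineal E x a := E x a /\ E (- x) (- a).

Lemma epi_lineal_scale E x a b : sublinear_epigraph E ->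
  epi_lineal E x a -> epi_lineal E (b *: x) (b * a).
Proof.
move=> hE [h1 h2]; case: (leP 0 b) => hb.
  by split; [exact: epi_scale | rewrite -scalerN -mulrN; exact: epi_scale].
have hb' : 0 <= - b by lra.
split; last by rewrite -scaleNr -mulNr; exact: epi_scale.
by have := epi_scale hE hb' h2; rewrite scalerN scaleNr mulrN mulNr !opprK.
Qed.

Lemma epi_lineal_sum E (I : finType) (x : I -> V) (a : I -> R) :
  sublinear_epigraph E -> (forall i, epi_lineal E (x i) (a i)) ->
  epi_lineal E (\sum_i x i) (\sum_i a i).
Proof.
move=> hE h; rewrite /epi_lineal -!sumrN.
by split; elim/big_rec2: _ => [|i c u _ hu]; try exact: epi0;
  apply: epi_add => //; case: (h i).
Qed.

(** One Hahn-Banach step. With [q] the sublinear function of [E] and [a = q e], the extension is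
    [inf_t (q (z + t e) - t a)], linear along [e]; the condition at 0 keeps it above -oo. *)
Lemma epi_extend1 E e : sublinear_epigraph E -> (forall c, E 0 c -> 0 <= c) ->
  exists E', [/\ sublinear_epigraph E', forall c, E' 0 c -> 0 <= c,
    forall x c, E x c -> E' x c & exists a, epi_lineal E' e a].
Proof.
move=> hE h0.
have [d' hd'] := epi_total hE (- e).
have lb c d : E e c -> E (- e) d -> - d <= c.
  by move=> hc hd; have := epi_add hE hc hd; rewrite subrr => /h0; lra.
pose S := [set c | E e c]; pose a := inf S.
have hinf : has_inf S.
  split; first exact: epi_total hE e.
  by exists (- d') => c hc; exact: lb hc hd'.
have ha c : E e c -> a <= c by move=> hc; apply: ge_inf => //; case: hinf.
have hb d : E (- e) d -> - d <= a.
  by move=> hd; apply: lb_le_inf => [|c hc]; [case: hinf | exact: lb hc hd].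
exists (fun z c => exists t, E (z + t *: e) (c + t * a)); split.
- split.
  + move=> x; have [c hc] := epi_total hE x.
    by exists c, 0; rewrite scale0r mul0r !addr0.
  + move=> x y c d [t ht] [s hs]; exists (t + s).
    by have := epi_add hE ht hs; rewrite scalerDl mulrDl !(addrACA _ (t *: _)) (addrACA c).
  + move=> b x c b0 [t ht]; exists (b * t).
    by have := epi_scale hE b0 ht; rewrite scalerDr mulrDr scalerA mulrA.
- move=> c [t]; rewrite add0r => ht.
  case: (ltgtP t 0) => t0.
  + have ti : 0 <= (- t)^-1 by rewrite invr_ge0; lra.
    have := epi_scale hE ti ht; rewrite scalerA invrN mulNr mulVf ?lt_eqF// scaleN1r.
    move=> /hb; rewrite mulNr opprK mulrDr mulKf ?lt_eqF// => h.
    have : t^-1 * c <= 0 by lra.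
    by rewrite nmulr_rle0 // invr_lt0.
  + have ti : 0 <= t^-1 by rewrite invr_ge0; lra.
    have := epi_scale hE ti ht; rewrite scalerA mulVf ?gt_eqF// scale1r.
    move=> /ha; rewrite mulrDr mulKf ?gt_eqF// => h.
    have : 0 <= t^-1 * c by lra.
    by rewrite pmulr_rge0 // invr_gt0.
  + by move: ht; rewrite t0 scale0r mul0r addr0 => /h0.
- by move=> x c hx; exists 0; rewrite scale0r mul0r !addr0.
- exists a; split; [exists (-1) | exists 1].
    by rewrite scaleN1r mulN1r !subrr; exact: epi0.
  by rewrite scale1r mul1r !addNr; exact: epi0.
Qed.

Lemma epi_extend E (s : seq V) :
  sublinear_epigraph E -> (forall c, E 0 c -> 0 <= c) ->
  exists E', [/\ sublinear_epigraph E', forall c, E' 0 c -> 0 <= c,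
    forall x c, E x c -> E' x c & forall e, e \in s -> exists a, epi_lineal E' e a].
Proof.
move=> hE h0; elim: s => [|e s [E1 [h1 h10 EE1 hs]]]; first by exists E.
have [E2 [h2 h20 E12 [a ha]]] := epi_extend1 e h1 h10.
exists E2; split => // [x c /EE1 /E12 //|f].
rewrite inE => /predU1P[->|/hs[b [hb hb']]]; first by exists a.
by exists b; split; exact: E12.
Qed.

End SublinearEpigraphs.

(** * Existence of functionals below sublinear functions *)

Section Functionals.
Variables (R : realType) (n : nat).
Notation V := 'rV[R]_n.
Implicit Types (E : V -> R -> Prop) (phi psi : dual R n).

Definition coord_form (a : 'I_n -> R) (x : V) : R^o := \sum_i x 0 i * a i.

Lemma coord_form_linear a : linear (coord_form a).
Proof.
move=> b x y; rewrite /coord_form scaler_sumr -big_split /=.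
by apply: eq_bigr => i _; rewrite !mxE mulrDl -mulrA.
Qed.

HB.instance Definition _ a :=
  GRing.isLinear.Build R V R^o *:%R (coord_form a) (coord_form_linear a).

Definition below phi E := forall x c, E x c -> phi x <= c.

(** In finite dimension, making the function linear along every basis vector makes it linear.
    Extension only lowers the function, so the result stays below [E]. *)
Lemma hahn_banach_below E : sublinear_epigraph E -> (forall c, E 0 c -> 0 <= c) ->
  exists phi, below phi E.
Proof.
move=> hE h0.
have [E' [hE' h0' EE' hs]] := epi_extend [seq delta_mx 0 i : V | i <- enum 'I_n] hE h0.
have /choice[a ha] : forall i : 'I_n, exists a, epi_lineal E' (delta_mx 0 i) a.
  by move=> i; apply: hs; apply/mapP; exists i; rewrite ?mem_enum.
exists (linfun (coord_form a)) => x c /EE' hx; rewrite lfunE /=.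
have [_ h] : epi_lineal E' x (coord_form a x).
  rewrite {1}[x]row_sum_delta; apply: epi_lineal_sum => // i.
  exact: epi_lineal_scale.
by have := epi_add hE' hx h; rewrite subrr => /h0'; rewrite subr_ge0.
Qed.

(** Sum rule for subdifferentials. A functional below [inf_y (q1 (z + y) + q2 y - phi y)] serves as
    [phi1]: [y = 0] gives [phi1 <= q1], and [z = - y] gives [phi - phi1 <= q2]. *)
Lemma below_sum E1 E2 phi : sublinear_epigraph E1 -> sublinear_epigraph E2 ->
  (forall x c1 c2, E1 x c1 -> E2 x c2 -> phi x <= c1 + c2) ->
  exists phi1 phi2, [/\ below phi1 E1, below phi2 E2 & phi = phi1 + phi2].
Proof.
move=> h1 h2 h.
have [|c|phi1 hphi1] := @hahn_banach_below (fun z c => exists y c1 c2,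
    [/\ E1 (z + y) c1, E2 y c2 & c = c1 + c2 - phi y]).
- split.
  + move=> x; have [c1 hc1] := epi_total h1 x.
    by exists (c1 + 0 - phi 0), 0, c1, 0; rewrite addr0; split => //; exact: epi0.
  + move=> x y c d [z [c1 [c2 [hz1 hz2 ->]]]] [w [d1 [d2 [hw1 hw2 ->]]]].
    exists (z + w), (c1 + d1), (c2 + d2); split; last by rewrite linearD /=; lra.
      by rewrite addrACA; exact: epi_add.
    exact: epi_add.
  + move=> b x c b0 [y [c1 [c2 [hy1 hy2 ->]]]].
    exists (b *: y), (b * c1), (b * c2); split.
    * by rewrite -scalerDr; exact: epi_scale.
    * exact: epi_scale.
    * by rewrite linearZ /= mulrBr mulrDr.
- by move=> [y [c1 [c2 [hy1 hy2 ->]]]]; rewrite add0r in hy1; have := h _ _ _ hy1 hy2; lra.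
- exists phi1, (phi - phi1); split; last by rewrite addrC subrK.
    move=> x c hc; apply: hphi1; exists 0, c, 0.
    by rewrite addr0 linear0 subr0 addr0; split => //; exact: epi0.
  move=> x c hc; rewrite !lfunE /= lfunE /=.
  have : phi1 (- x) <= 0 + c - phi x.
    by apply: hphi1; exists x, 0, c; split => //; rewrite addNr; exact: epi0.
  by rewrite linearN /=; lra.
Qed.

End Functionals.

(** * Norming functionals and the dual unit ball *)

Section Norm.
Variables (R : realType) (n : nat) (nrm : 'rV[R]_n -> R).
Hypothesis nrm_norm : is_norm nrm.
Notation V := 'rV[R]_n.
Implicit Types (u x y : V) (phi psi : dual R n).

Lemma nrmZ (a : R) x : nrm (a *: x) = `|a| * nrm x.
Proof. exact: is_norm_homogeneous. Qed.

Lemma nrmD x y : nrm (x + y) <= nrm x + nrm y.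
Proof. exact: is_norm_triangle. Qed.

Lemma nrm0 : nrm 0 = 0.
Proof. by rewrite -(scale0r 0) nrmZ normr0 mul0r. Qed.

Lemma nrmN x : nrm (- x) = nrm x.
Proof. by rewrite -scaleN1r nrmZ normrN1 mul1r. Qed.

Lemma nrm_ge0 x : 0 <= nrm x.
Proof. by have := nrmD x (- x); rewrite subrr nrm0 nrmN; lra. Qed.

Lemma nrm_gt0 x : x != 0 -> 0 < nrm x.
Proof.
rewrite lt0r nrm_ge0 andbT; apply: contra_neq.
exact: is_norm_definite nrm_norm _.
Qed.

(* A dense part of the epigraph of the one-sided directional derivative of [nrm]
   at [u]: the derivative itself need not be attained by a difference quotient. *)
Definition nrm_deriv u y c :=
  exists2 e0 : R, 0 < e0 & forall e, 0 < e <= e0 -> nrm (u + e *: y) <= nrm u + e * c.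

Lemma nrm_deriv_epigraph u : sublinear_epigraph (nrm_deriv u).
Proof.
split.
- move=> x; exists (nrm x), 1; rewrite ?ltr01// => e /andP[e0 _].
  by rewrite (le_trans (nrmD _ _)) // nrmZ gtr0_norm.
- move=> x y c d [e e0 he] [f f0 hf].
  (* Halved because [u + g (x + y)] is the midpoint of [u + 2 g x] and [u + 2 g y]. *)
  exists (Num.min e f / 2); first by rewrite divr_gt0 // lt_min e0.
  move=> g /andP[g0]; rewrite ler_pdivlMr // le_min => /andP[ge gf].
  have /he h1 : 0 < g * 2 <= e by rewrite ge mulr_gt0.
  have /hf h2 : 0 < g * 2 <= f by rewrite gf mulr_gt0.
  have -> : u + g *: (x + y) = 2^-1 *: ((u + (g * 2) *: x) + (u + (g * 2) *: y)).
    rewrite addrACA -mulr2n -scaler_nat -(scalerDr (g * 2)) [RHS]scalerDr !scalerA mulVf ?pnatr_eq0 // scale1r.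
    by congr (_ + _ *: _); field.
  rewrite nrmZ ger0_norm ?invr_ge0 //.
  have := nrmD (u + (g * 2) *: x) (u + (g * 2) *: y); nra.
- move=> a x c; rewrite le_eqVlt => /predU1P[<-|a0] [e e0 he].
    exists 1; rewrite ?ltr01// => f _.
    by rewrite scale0r scaler0 mul0r mulr0 !addr0.
  exists (e / a); first by rewrite divr_gt0.
  move=> f; rewrite ler_pdivlMr // => /andP[f0 fa].
  by rewrite scalerA mulrA; apply: he; rewrite mulr_gt0.
Qed.

(** The directional derivative at [u] is at most [nrm x] in direction [x], and at most [- nrm u] in
    direction [- u] because [u - e u = (1 - e) u]. *)
Lemma below_nrm_deriv phi u : below phi (nrm_deriv u) ->
  (forall x, phi x <= nrm x) /\ phi u = nrm u.
Proof.
move=> h; have hle x : phi x <= nrm x.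
  apply: h; exists 1; rewrite ?ltr01// => e /andP[e0 _].
  by rewrite (le_trans (nrmD _ _)) // nrmZ gtr0_norm.
split => //; apply/le_anti; rewrite hle /=.
suff : phi (- u) <= - nrm u by rewrite linearN lerN2.
apply: h; exists 1; rewrite ?ltr01// => e /andP[e0 e1].
rewrite scalerN -{1}[u]scale1r -scalerBl nrmZ ger0_norm; last by lra.
by rewrite mulrBl mul1r mulrN.
Qed.

Lemma norming_functional u : exists phi,
  (forall x, phi x <= nrm x) /\ phi u = nrm u.
Proof.
have [c [e e0 h]|phi /below_nrm_deriv] := hahn_banach_below (nrm_deriv_epigraph u).
  have := h e; rewrite e0 lexx scaler0 addr0 => /(_ isT).
  by rewrite lerDl pmulr_rge0.
by exists phi.
Qed.

(** Ensures that [sup] in [dual_norm] is an upper bound. By induction on the dimension of a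
    subspace, a vector [e] is split off along the kernel of a functional [f] norming [e]. *)
Lemma functional_bounded phi : exists K, forall x, phi x <= K * nrm x.
Proof.
suff h d (U : {vspace V}) : (\dim U <= d)%N ->
    exists2 K, 0 <= K & forall x, x \in U -> phi x <= K * nrm x.
  by have [K _ hK] := h _ fullv (leqnn _); exists K => x; rewrite hK ?memvf.
elim: d => [|d IH] in U *.
  rewrite leqn0 dimv_eq0 => /eqP ->; exists 0 => // x.
  by rewrite memv0 => /eqP ->; rewrite linear0 mul0r.
move=> hU; have [->|U0] := eqVneq U 0%VS.
  by exists 0 => // x; rewrite memv0 => /eqP ->; rewrite linear0 mul0r.
pose e := vpick U; have e0 : e != 0 by rewrite vpick0.
have [f [fle fe]] := norming_functional e.
have fgt0 : 0 < f e by rewrite fe nrm_gt0.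
have [|K K0 hK] := IH (U :&: lker f)%VS.
  rewrite -ltnS (leq_trans _ hU) // ltn_neqAle dimvS ?capvSl // andbT.
  apply/negP => /eqP hd; have : (U <= U :&: lker f)%VS.
    by rewrite -(geq_leqif (dimv_leqif_sup (capvSl _ _))) hd.
  rewrite subv_cap => /andP[_ /subvP/(_ _ (memv_pick U))].
  by rewrite memv_ker gt_eqF.
have fabs x : `|f x| <= nrm x.
  by rewrite ler_norml fle andbT lerNl -(nrmN x); have := fle (- x); rewrite linearN.
(* The kernel part [x - t e] has norm at most [2 nrm x], and [t e] has norm at most [nrm x]. *)
exists (K * 2 + `|phi e| / nrm e); first by rewrite addr_ge0 // ?mulr_ge0 // invr_ge0 nrm_ge0.
move=> x xU; pose t := f x / f e.
have ht : `|t| * nrm e <= nrm x.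
  by rewrite normrM normfV (gtr0_norm fgt0) fe mulfVK // gt_eqF // -fe.
have /hK : x - t *: e \in (U :&: lker f)%VS.
  rewrite memv_cap memvB ?memvZ ?memv_pick //= memv_ker linearB linearZ /=.
  by rewrite /t [_ *: _]mulfVK ?subrr // gt_eqF.
rewrite linearB linearZ /= => h1.
have h2 : nrm (x - t *: e) <= 2 * nrm x.
  by have := nrmD x (- (t *: e)); rewrite nrmN nrmZ; lra.
have h3 : K * nrm (x - t *: e) <= K * (2 * nrm x) by rewrite ler_wpM2l.
have h4 : t *: phi e <= `|phi e| / nrm e * nrm x.
  rewrite (le_trans (ler_norm _)) // normrM mulrAC ler_pdivlMr -?fe //.
  by rewrite mulrAC [leRHS]mulrC ler_wpM2r // fe.
lra.
Qed.

Lemma dual_norm_le1P phi : dual_norm nrm phi <= 1 <-> forall x, phi x <= nrm x.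
Proof.
split => [h x|h].
- have [->|x0] := eqVneq x 0; first by rewrite linear0 nrm0.
  have nx := nrm_gt0 x0.
  have : phi ((nrm x)^-1 *: x) <= dual_norm nrm phi.
    apply: ub_le_sup.
      by have [K hK] := functional_bounded phi; exists K => _ [y /= hy <-]; rewrite -[K]mulr1 -hy.
    by exists ((nrm x)^-1 *: x) => //=; rewrite nrmZ gtr0_norm ?invr_gt0 // mulVf ?gt_eqF.
  move=> /le_trans /(_ h); rewrite linearZ /= [_ *: _]mulrC ler_pdivrMr // mul1r.
  exact.
- rewrite /dual_norm; set S := [set _ | _ in _].
  (* For [n = 0] the unit sphere is empty and [sup] is 0. *)
  have [->|/set0P S0] := eqVneq S set0; first by rewrite sup0.
  by apply: ge_sup => // _ [y /= hy <-]; rewrite -hy.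
Qed.

Lemma normingP u phi : u != 0 ->
  norming nrm u phi <-> (forall x, phi x <= nrm x) /\ phi u = nrm u.
Proof.
move=> u0; split => [[h ->]|[h hu]].
  by split => //; apply/dual_norm_le1P; rewrite h.
split => //; apply/le_anti; apply/andP; split; first exact/dual_norm_le1P.
have nu := nrm_gt0 u0; apply: ub_le_sup.
  by exists 1 => _ [y /= hy <-]; rewrite -hy.
exists ((nrm u)^-1 *: u); first by rewrite /= nrmZ gtr0_norm ?invr_gt0 // mulVf ?gt_eqF.
by rewrite linearZ /= hu [LHS]mulVf ?gt_eqF.
Qed.

End Norm.

(** * Leaves, trees and stars *)

Section Graphs.
Variables (P : choiceType).
Implicit Types (e : rel P) (W : {fset P}).

(** Rotated to start at the leaf [a], a longer cycle would contain [x] both right after [a] and at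
    its end. *)
Lemma ucycle_through_leaf e a x (c : seq P) : symmetric e ->
  (forall b, e a b -> b = x) -> ucycle e c -> a \in c -> (size c <= 2)%N.
Proof.
move=> esym leaf uc ac; have [i s hs] := rot_to ac.
have : ucycle e (a :: s) by rewrite -hs rot_ucycle.
rewrite -(size_rot i) hs; case/andP; case: s {hs} => [|b [|d s]] //=.
rewrite rcons_path => /and4P[/leaf -> _ _]; rewrite esym => /leaf h.
by case/and3P=> _; rewrite -h mem_last.
Qed.

Lemma path_exits e W x (s : seq P) : path e x s -> x \in W -> last x s \notin W ->
  exists a b, [/\ a \in W, b \notin W & e a b].
Proof.
elim: s x => [|y s IH] x /=; first by move=> _ ->.
move=> /andP[exy ps] xW; have [yW|yW] := boolP (y \in W); first exact: IH.
by exists x, y.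
Qed.

Definition add_leaf (T : graph P) (x y : P) : graph P :=
  Graph (y |` verts T)%fset
    (fun a b => [|| edge T a b, (a == x) && (b == y) | (a == y) && (b == x)]).

(** A cycle through [y] is short since [y] is a leaf; any other cycle lies in [T]. *)
Lemma add_leaf_tree (T : graph P) (x y : P) : is_tree T -> x \in verts T ->
  y \notin verts T -> is_tree (add_leaf T x y).
Proof.
move=> [[esym eirr everts] V0 conn acyc] xV yV; set T' := add_leaf T x y.
have xy : x != y by apply: contraNneq yV => <-.
have noedge b : edge T y b = false.
  by apply/negP => /everts/andP[h]; rewrite h in yV.
have sym : symmetric (edge T').
  by move=> a b /=; rewrite esym (andbC (b == x)) (andbC (b == y)) (orbC (_ && _)).
have leaf b : edge T' y b -> b = x.
  by rewrite /= noedge (eq_sym y x) (negPf xy) eqxx /= => /eqP.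
have sub a s : path (edge T) a s -> path (edge T') a s.
  by apply: sub_path => u v /= ->.
split => //=.
- split => //= [a|a b].
  + by rewrite eirr /=; apply/negP => /orP[] /andP[/eqP-> ]; rewrite ?(negPf xy) // eq_sym (negPf xy).
  + by rewrite !in_fset1U => /or3P[/everts/andP[-> ->]|/andP[/eqP-> /eqP->]|/andP[/eqP-> /eqP->]];
      rewrite ?eqxx ?xV ?orbT.
- by apply/fset0Pn; exists y; rewrite fset1U1.
- move=> a b; rewrite !in_fset1U => /predU1P[->|aV] /predU1P[->|bV].
  + by exists [::].
  + have [s ps <-] := conn x b xV bV; exists (x :: s) => //=.
    by rewrite !eqxx !orbT sub.
  + have [s ps hs] := conn a x aV xV; exists (rcons s y); rewrite ?last_rcons //.
    by rewrite rcons_path sub //= hs !eqxx orbT.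
  + by have [s ps <-] := conn a b aV bV; exists s; rewrite ?sub.
- move=> c uc; have [yc|yc] := boolP (y \in c).
    exact: ucycle_through_leaf sym leaf uc yc.
  apply: acyc; case/andP: uc => cc uc; rewrite /ucycle uc andbT.
  apply/(sub_in_cycle (P := [pred z | z != y])): cc => [u v /= uy vy|].
    by rewrite (negPf uy) (negPf vy) !andbF !orbF.
  by apply/allP => z zc /=; apply: contraNneq yc => <-.
Qed.

Lemma star_tree p0 (N : {fset P}) : p0 \notin N -> is_tree (star p0 N).
Proof.
move=> p0N.
have sym : symmetric (edge (star p0 N)) by move=> a b /=; rewrite orbC andbC (andbC (a == p0)).
have leaf a b : a != p0 -> edge (star p0 N) a b -> b = p0.
  by move=> /negPf /= -> /= /andP[_ /eqP].
split => //.
- split => //= [a|a b].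
  + rewrite (andbC (a \in N)) orbb; apply/negP => /andP[/eqP-> h].
    by rewrite h in p0N.
  + by rewrite !in_fset1U => /orP[] /andP[-> ->]; rewrite ?orbT.
- by apply/fset0Pn; exists p0; rewrite fset1U1.
- have to a : a \in N -> edge (star p0 N) a p0 by move=> /= ->; rewrite eqxx orbT.
  move=> a b /=; rewrite !in_fset1U => /predU1P[->|aN] /predU1P[->|bN].
  + by exists [::].
  + by exists [:: b] => //=; rewrite eqxx bN.
  + by exists [:: p0] => //=; rewrite eqxx aN orbT.
  + by exists [:: p0; b] => //=; rewrite eqxx aN bN orbT.
- move=> c uc; have [/hasP[a ac ap0]|/hasPn h] := boolP (has (fun a => a != p0) c).
    by apply: ucycle_through_leaf sym _ uc ac => b; exact: leaf.
  case/andP: uc h => _; case: c => [|a [|b c]] //= /andP[].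
  rewrite inE negb_or => /andP[/eqP ab _] _ h.
  have at_p0 d : d \in [:: a, b & c] -> d = p0 by move=> /h /negbNE /eqP.
  case: ab; transitivity p0; [|symmetry]; apply: at_p0; by rewrite !inE eqxx ?orbT.
Qed.

End Graphs.

(** * Rooted networks and their lengths *)

Section Networks.
Variables (R : realType) (n : nat) (nrm : 'rV[R]_n -> R).
Hypothesis nrm_norm : is_norm nrm.
Notation V := 'rV[R]_n.
Implicit Types (e : rel V) (W : {fset V}) (L : R).

Definition edge_length e W :=
  2^-1 * \sum_(x <- W) \sum_(y <- W | e x y) nrm (x - y).

Lemma edge_lengthU1 e W y : symmetric e -> irreflexive e -> y \notin W ->
  edge_length e (y |` W)%fset = edge_length e W + \sum_(x <- W | e x y) nrm (x - y).
Proof.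
move=> esym eirr yW; rewrite /edge_length big_fsetU1 //=.
have inner x : \sum_(z <- (y |` W)%fset | e x z) nrm (x - z) =
    (if e x y then nrm (x - y) else 0) + \sum_(z <- W | e x z) nrm (x - z).
  by rewrite big_mkcond big_fsetU1 //= -big_mkcond.
rewrite (eq_bigr _ (fun x _ => inner x)) inner eirr add0r big_split /= -big_mkcond /=.
have -> : \sum_(z <- W | e y z) nrm (y - z) = \sum_(z <- W | e z y) nrm (z - y).
  by apply: eq_big => [z|z _]; [rewrite esym | rewrite -(nrmN nrm_norm) opprB].
by field.
Qed.

(* Built from the root by attaching one new point at a time; the real number
   bounds the total length. *)
Inductive network (r : V) : {fset V} -> R -> Prop :=
| NetworkRoot L : 0 <= L -> network r [fset r]%fset L
| NetworkEdge W x y L L' : network r W L -> x \in W -> y \notin W ->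
    L + nrm (x - y) <= L' -> network r (y |` W)%fset L'.

Lemma network_weaken r W L L' : L <= L' -> network r W L -> network r W L'.
Proof.
move=> LL' h; case: h LL' => [M M0|{}W x y M M' h xW yW hM] le.
  by apply: NetworkRoot; lra.
by apply: NetworkEdge h xW yW _; lra.
Qed.

Lemma network_root r W L : network r W L -> r \in W.
Proof. by elim=> *; rewrite ?fset11 // fset1Ur. Qed.

Lemma network_extend r W L x y : network r W L -> x \in W ->
  network r (y |` W)%fset (L + nrm (x - y)).
Proof.
move=> h xW; have [yW|yW] := boolP (y \in W); last exact: NetworkEdge h xW yW _.
by rewrite mem_fset1U //; apply: network_weaken h; rewrite lerDl nrm_ge0.
Qed.

(** The second construction is replayed on the first network. Common points are harmless: attaching
    a point already present only loosens the length bound. *)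
Lemma network_merge r x W1 W2 L1 L2 : network r W1 L1 -> x \in W1 ->
  network x W2 L2 -> network r (W2 `|` W1)%fset (L1 + L2).
Proof.
move=> h1 xW h2; elim: h2 => [L L0|W a b L L' _ IH aW _ hL].
  by rewrite mem_fset1U //; apply: network_weaken h1; rewrite lerDl.
rewrite -fsetUA; apply: network_weaken (network_extend b IH (_ : a \in _)).
  by lra.
by rewrite in_fsetU aW.
Qed.

Lemma network_tree r W L : network r W L ->
  exists T : graph V, [/\ is_tree T, verts T = W & tree_length nrm T <= L].
Proof.
elim=> [{}L L0|{}W x y {}L L' _ [T [Ttree TW TL]] xW yW hL].
  exists (Graph [fset r]%fset (fun _ _ => false)); split => //; last first.
    by rewrite /tree_length big1 ?mulr0 // => z _; rewrite big_pred0.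
  split => //=; first by apply/fset0Pn; exists r; rewrite fset11.
    by move=> a b /fset1P -> /fset1P ->; exists [::].
  by move=> [|a [|b c]].
subst W; exists (add_leaf T x y).
have T'tree := add_leaf_tree Ttree xW yW; split => //.
have [[esym eirr _] _ _ _] := T'tree.
have [[_ _ everts] _ _ _] := Ttree.
rewrite /tree_length -/(edge_length _ _) edge_lengthU1 //=.
have neq z : z \in verts T -> (z == y) = false.
  by move=> zT; apply: contraNF yW => /eqP <-.
have -> : \sum_(z <- verts T | [|| edge T z y, (z == x) && (y == y) | (z == y) && (y == x)])
    nrm (z - y) = nrm (x - y).
  rewrite big_seq_cond (eq_bigl (fun z => (z \in verts T) && (z == x))); last first.
    move=> z; have [zT|//] := boolP (z \in verts T); rewrite neq // eqxx andbT orbF /=.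
    case: (boolP (edge T z y)) => // /everts/andP[_ h]; by rewrite h in yW.
  by rewrite -big_seq_cond -big_filter filter_pred1_uniq ?fset_uniq // big_seq1.
suff -> : edge_length (edge (add_leaf T x y)) (verts T) = tree_length nrm T by lra.
congr (_ * _); apply: eq_big_seq => a aT; rewrite big_seq_cond [RHS]big_seq_cond.
apply: eq_bigl => b; have [bT|//] := boolP (b \in verts T).
by rewrite /= !neq // andbF !orbF.
Qed.

(** Connectedness gives an edge [a b] leaving [W] as long as a vertex is missing. Adding [b] to [W]
    increases the induced length by at least [nrm (a - b)]. *)
Lemma tree_network (T : graph V) r : is_tree T -> r \in verts T ->
  network r (verts T) (tree_length nrm T).
Proof.
move=> [[esym eirr everts] _ conn _] rT; rewrite /tree_length -/(edge_length _ _).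
suff h k W : (#|` (verts T `\` W)%fset| <= k)%N -> (W `<=` verts T)%fset ->
    network r W (edge_length (edge T) W) ->
    network r (verts T) (edge_length (edge T) (verts T)).
  apply: (h _ [fset r]%fset (leqnn _)); first by rewrite fsub1set.
  apply: NetworkRoot; rewrite mulr_ge0 // ?invr_ge0 // sumr_ge0 // => x _.
  by apply: sumr_ge0 => y _; exact: nrm_ge0.
elim: k W => [|k IH] W hk WT hW.
  move: hk; rewrite leqn0 cardfs_eq0 fsetD_eq0 => TW.
  by have <- : W = verts T by apply/eqP; rewrite eqEfsubset WT.
have [/eqP|/fset0Pn[z]] := eqVneq (verts T `\` W)%fset fset0.
  rewrite fsetD_eq0 => TW.
  by have <- : W = verts T by apply/eqP; rewrite eqEfsubset WT.
rewrite in_fsetD => /andP[zW zT].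
have [s ps hs] := conn r z rT zT.
have [||a [b [aW bW eab]]] := path_exits ps (W := W).
- exact: network_root hW.
- by rewrite hs.
have bT : b \in verts T by case/andP: (everts _ _ eab).
apply: (IH (b |` W)%fset).
- rewrite -ltnS (leq_trans _ hk) //; apply: fproper_ltn_card.
  rewrite fproperE fsetDS ?fsubsetU1 //=; apply/fsubsetPn.
  by exists b; rewrite !in_fsetD ?bW ?bT // fset1U1.
- by rewrite fsubUset fsub1set bT.
- apply: (NetworkEdge hW aW bW); rewrite (edge_lengthU1 esym eirr bW) lerD2l.
  rewrite -big_filter (bigD1_seq a) /=; last by rewrite filter_uniq ?fset_uniq.
    by rewrite lerDl sumr_ge0 // => x _; exact: nrm_ge0.
  by rewrite mem_filter eab.
Qed.

End Networks.

Lemma sum_setU (M : nmodType) (I : finType) (S1 S2 : {set I}) (F : I -> M) :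
  (S1 :&: S2)%SET = finset.set0 ->
  \sum_(i in S1 :|: S2) F i = \sum_(i in S1) F i + \sum_(i in S2) F i.
Proof.
move=> dis; rewrite -bigU -?finset.setI_eq0 ?dis //.
by apply: eq_bigl => i; rewrite !inE.
Qed.

(** * From parenthesizations to trees and back *)

Section Parenthesizations.
Variables (R : realType) (n : nat) (nrm : 'rV[R]_n -> R).
Hypothesis nrm_norm : is_norm nrm.
Notation V := 'rV[R]_n.
Variables (I : finType) (p : I -> V) (p0 : V).
Hypothesis p_neq_p0 : forall i, p i != p0.
Implicit Types (S : {set I}) (C : set (dual R n)).

Notation Sigma := (fun i => norming nrm (p i - p0)).

Let pB_neq0 i : p i - p0 != 0.
Proof. by rewrite subr_eq0. Qed.

(* [E] bounds the first-order increase in length when the root of the bracketing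
   leaves [p0] in direction [- x], starting from the degenerate tree in which all
   Steiner points coincide with [p0]. *)
Lemma parenthesization_epigraph S C : parenthesization nrm Sigma S C ->
  exists E, [/\ sublinear_epigraph E, forall phi, below phi E -> C phi &
    forall x c, E x c -> exists2 e0 : R, 0 < e0 & forall e, 0 < e <= e0 ->
      exists2 W, network nrm (p0 - e *: x) W (e * c + \sum_(i in S) nrm (p i - p0)) &
        forall i, i \in S -> p i \in W].
Proof.
elim=> {S C} [i|S1 S2 C1 C2 dis _ [E1 [h1 b1 n1]] _ [E2 [h2 b2 n2]]].
  exists (nrm_deriv nrm (p i - p0)); split; first exact: nrm_deriv_epigraph.
    by move=> phi /(below_nrm_deriv nrm_norm) h; apply/normingP.
  move=> x c [e0 he0 h]; exists e0 => // e /h le.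
  exists [fset p i; p0 - e *: x]%fset; last first.
    by move=> j /set1P ->; rewrite fset21.
  rewrite big_set1.
  have := network_extend nrm_norm (p i) (NetworkRoot nrm (p0 - e *: x) (lexx 0)) (fset11 _).
  have -> : p0 - e *: x - p i = - (p i - p0 + e *: x) by rewrite opprD opprB addrAC.
  by apply: network_weaken; rewrite add0r (nrmN nrm_norm) (le_trans le) // addrC.
exists (fun x c => exists y c1 c2, [/\ E1 y c1, E2 y c2 & c1 + c2 + nrm (x - y) <= c]).
split.
- split.
  + move=> x; have [c1 hc1] := epi_total h1 x; have [c2 hc2] := epi_total h2 x.
    by exists (c1 + c2 + nrm (x - x)), x, c1, c2.
  + move=> x x' c c' [y [c1 [c2 [hc1 hc2 hc]]]] [y' [c1' [c2' [hc1' hc2' hc']]]].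
    exists (y + y'), (c1 + c1'), (c2 + c2'); split; try exact: epi_add.
    by rewrite opprD (addrACA x); have := nrmD nrm_norm (x - y) (x' - y'); lra.
  + move=> a x c a0 [y [c1 [c2 [hc1 hc2 hc]]]].
    exists (a *: y), (a * c1), (a * c2); split; try exact: epi_scale.
    by rewrite -scalerBr nrmZ // ger0_norm // -!mulrDr ler_wpM2l.
(* The choice [y = 0] puts [phi] in the dual unit ball; the choice [y = x] gives [phi <= q1 + q2],
   so that [phi] splits. *)
- move=> phi hphi; split; last first.
    apply/dual_norm_le1P => // x; apply: hphi; exists 0, 0, 0.
    by rewrite subr0 !add0r; split => //; exact: epi0.
  have [|phi1 [phi2 [/b1 hphi1 /b2 hphi2 ->]]] := below_sum h1 h2 (phi := phi).
    move=> x c1 c2 hc1 hc2; apply: hphi; exists x, c1, c2.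
    by rewrite subrr nrm0 // addr0.
  by exists phi1 => //; exists phi2.
- move=> x c [y [c1 [c2 [hc1 hc2 hc]]]].
  have [e1 e10 {}n1] := n1 _ _ hc1; have [e2 e20 {}n2] := n2 _ _ hc2.
  exists (Num.min e1 e2); first by rewrite lt_min e10.
  move=> e; rewrite le_min => /and3P[e0 le1 le2].
  have [|W1 hW1 pW1] := n1 e; first by rewrite e0.
  have [|W2 hW2 pW2] := n2 e; first by rewrite e0.
  (* The root [r] is joined to [s], from which both subnetworks hang; this edge has length
     [e * nrm (x - y)]. *)
  set r := p0 - e *: x; set s := p0 - e *: y in hW1 hW2.
  have hrs := network_extend nrm_norm s (NetworkRoot nrm r (lexx 0)) (fset11 _).
  have hr1 := network_merge nrm_norm hrs (fset1U1 _ _) hW1.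
  have hr2 := network_merge nrm_norm hr1 (_ : s \in _) hW2.
  exists (W2 `|` (W1 `|` (s |` [fset r])))%fset.
    apply: network_weaken (hr2 _); last by rewrite !inE eqxx !orbT.
    rewrite sum_setU //.
    have -> : r - s = - (e *: (x - y)).
      by rewrite /r /s scalerBr !opprB addrC addrA subrK.
    rewrite (nrmN nrm_norm) (nrmZ nrm_norm) gtr0_norm //.
    by have := ler_wpM2l (ltW e0) hc; rewrite !mulrDr; lra.
  by move=> i; rewrite !inE => /orP[/pW1|/pW2] ->; rewrite ?orbT.
Qed.

Lemma parenthesization_le S C phi x : parenthesization nrm Sigma S C -> C phi ->
  phi x <= nrm x.
Proof.
case=> [i /normingP-/(_ nrm_norm (pB_neq0 i))[] //|? ? ? ? _ _ _ [_]].
by move/(dual_norm_le1P nrm_norm).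
Qed.

(* If the terminals in [S] hang off [x] in subtrees of total length [l], these
   subtrees prescribe a bracketing [C] of [S], and each member of [C] bounds [l]
   from below. *)
Definition carried S (l : R) (x : V) : Prop := if S == finset.set0 then is_true (0 <= l) else
  exists2 C, parenthesization nrm Sigma S C &
    forall psi, C psi -> \sum_(i in S) nrm (p i - p0) <= psi (x - p0) + l.

(** Passing from [x] to [y] changes the value of [psi] by [psi (x - y) <= nrm (x - y)]; this is
    where truncation to the dual unit ball enters. *)
Lemma carried_edge S l x y : carried S l x -> carried S (l + nrm (x - y)) y.
Proof.
rewrite /carried; case: eqP => _ => [l0|[C hC h]].
  by rewrite addr_ge0 // nrm_ge0.
exists C => // psi Cpsi; rewrite (le_trans (h _ Cpsi)) //.
have -> : x - p0 = (y - p0) + (x - y) by rewrite [RHS]addrC addrA subrK.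
by rewrite linearD /=; have := parenthesization_le (x - y) hC Cpsi; lra.
Qed.

Lemma carried_weaken S l l' x : l <= l' -> carried S l x -> carried S l' x.
Proof.
rewrite /carried => ll'; case: eqP => _ => [l0|[C hC h]]; first exact: le_trans ll'.
by exists C => // psi /h /le_trans; apply; rewrite lerD2l.
Qed.

Lemma carried_merge S1 S2 l1 l2 x : (S1 :&: S2)%SET = finset.set0 ->
  carried S1 l1 x -> carried S2 l2 x -> carried (S1 :|: S2)%SET (l1 + l2) x.
Proof.
move=> dis h1 h2.
(* The empty family has no parenthesization, so an empty side is dropped. *)
have [e1|n1] := eqVneq S1 finset.set0.
  rewrite e1 finset.set0U; apply: carried_weaken h2.
  by move: h1; rewrite /carried e1 eqxx lerDr.
have [e2|n2] := eqVneq S2 finset.set0.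
  rewrite e2 finset.setU0; apply: carried_weaken h1.
  by move: h2; rewrite /carried e2 eqxx lerDl.
move: h1 h2; rewrite /carried finset.setU_eq0 (negPf n1) (negPf n2) /=.
move=> [C1 hC1 h1] [C2 hC2 h2].
exists (reduced_sum nrm C1 C2); first exact: ParSum.
move=> _ [[psi1 C1psi [psi2 C2psi <-]] _]; rewrite sum_setU // lfunE /=.
by have := h1 _ C1psi; have := h2 _ C2psi; lra.
Qed.

(* Induction prunes the points of the network in reverse order of attachment. *)
Lemma carried_network r W L S (g : I -> V) (l : V -> R) : network nrm r W L ->
  (forall i, i \in S -> g i \in W) ->
  (forall v, v \in W -> carried [set i in S | g i == v]%SET (l v) v) ->
  carried S (L + \sum_(v <- W) l v) r.
Proof.
move=> hW; elim: hW g l => {W L} [L L0|W x y L L' _ IH xW yW hL] g l gW hl.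
  have := hl r (fset11 r); rewrite big_seq_fset1.
  have -> : [set i in S | g i == r]%SET = S.
    apply/setP => i; rewrite inE; case: (boolP (i \in S)) => // /gW.
    by move/fset1P ->; rewrite eqxx.
  by apply: carried_weaken; rewrite lerDr.
have xy : x != y by apply: contraNneq yW => <-.
(* [g] assigns to each terminal the point now carrying it. Pruning [y] hands its terminals to [x]
   and charges [x] with the length at [y] plus the edge. *)
pose g' i := if g i == y then x else g i.
pose l' v := l v + (if v == x then l y + nrm (y - x) else 0).
apply: carried_weaken (IH g' l' _ _).
- rewrite big_fsetU1 //= big_split /=.
  have -> : \sum_(v <- W) (if v == x then l y + nrm (y - x) else 0) = l y + nrm (y - x).
    by rewrite -big_mkcond -big_filter filter_pred1_uniq ?fset_uniq // big_seq1.
  by rewrite -(nrmN nrm_norm) opprB; lra.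
- move=> i /gW; rewrite in_fset1U /g'; case: eqP => // _ _; exact: xW.
- move=> v vW; rewrite /l'.
  have vy : v != y by apply: contraNneq yW => <-.
  have := hl v (fset1Ur _ vW); have [->|vx] := eqVneq v x => hv.
    have -> : [set i in S | g' i == x]%SET =
        ([set i in S | g i == x] :|: [set i in S | g i == y])%SET.
      apply/setP => i; rewrite !inE /g' -andb_orr.
      by case: ifP => _; rewrite ?eqxx ?orbT ?orbF.
    apply: carried_merge hv _; last exact/carried_edge/hl/fset1U1.
    apply/setP => i; rewrite !inE; apply/negP => /andP[/andP[_ /eqP->]].
    by rewrite (negPf xy) andbF.
  have -> : [set i in S | g' i == v]%SET = [set i in S | g i == v]%SET.
    apply/setP => i; rewrite !inE /g'; case: (g i =P y) => // ->.
    by rewrite !(eq_sym _ v) (negPf vx) (negPf vy).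
  by rewrite addr0.
Qed.

Hypothesis p_inj : injective p.

(** By injectivity at most one terminal sits at [v], and its norming functionals give equality with
    length 0. *)
Lemma carried_terminals S v : carried [set i in S | p i == v]%SET 0 v.
Proof.
rewrite /carried; case: eqP => [_|/eqP/set0Pn[i]]; first exact: lexx.
rewrite inE => /andP[iS /eqP <-].
have -> : [set j in S | p j == p i]%SET = [set i]%SET.
  apply/setP => j; rewrite !inE (inj_eq p_inj).
  by case: eqP => [->|]; rewrite ?iS ?andbF.
exists (norming nrm (p i - p0)); first exact: (ParSingle _ Sigma).
by move=> psi [_ ->]; rewrite big_set1 addr0.
Qed.

Lemma parenthesization_length_bound r W L S : network nrm r W L -> S != finset.set0 ->
  (forall i, i \in S -> p i \in W) ->
  exists2 C, parenthesization nrm Sigma S C &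
    forall psi, C psi -> \sum_(i in S) nrm (p i - p0) <= psi (r - p0) + L.
Proof.
move=> hW S0 pW.
have := carried_network (l := fun=> 0) hW pW (fun v _ => carried_terminals S v).
by rewrite /carried (negPf S0) big1_eq addr0.
Qed.

Lemma star_length :
  tree_length nrm (star p0 [fset p i | i in I]%fset) = \sum_i nrm (p i - p0).
Proof.
set N := [fset p i | i in I]%fset.
have p0N : p0 \notin N.
  by apply/imfsetP => -[i _ h]; have := p_neq_p0 i; rewrite h eqxx.
have notp0 x : x \in N -> (x == p0) = false.
  by move=> xN; apply: contraNF p0N => /eqP <-.
rewrite /tree_length /= big_fsetU1 //=.
have -> : \sum_(y <- (p0 |` N)%fset | (p0 == p0) && (y \in N) || (p0 \in N) && (y == p0))
    nrm (p0 - y) = \sum_(x <- N) nrm (x - p0).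
  rewrite big_mkcond big_fsetU1 //= (negPf p0N) eqxx add0r.
  by apply: eq_big_seq => x /= ->; rewrite -(nrmN nrm_norm) opprB.
have -> : \sum_(x <- N) \sum_(y <- (p0 |` N)%fset |
    (x == p0) && (y \in N) || (x \in N) && (y == p0)) nrm (x - y) = \sum_(x <- N) nrm (x - p0).
  apply: eq_big_seq => x xN; rewrite notp0 // xN /= big_mkcond big_fsetU1 //= eqxx.
  by rewrite big_seq big1 ?addr0 // => y yN; rewrite notp0.
rewrite big_imfset /=; last by move=> i j _ _; exact: p_inj.
by rewrite big_enum /=; field.
Qed.

(** An epigraph value [c] in direction [x] yields, at small scale [e], a Steiner tree at most
    [e * c] longer than the star. Minimality forces [0 <= c], so 0 is below [E]. *)
Lemma SMT_star_zero_in C :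
  is_SMT nrm [fset p i | i in I]%fset (star p0 [fset p i | i in I]%fset) ->
  parenthesization nrm Sigma [set: I]%SET C -> C 0.
Proof.
move=> [_ smt] /parenthesization_epigraph[E [_ CE hE]].
apply: CE => x c /hE[e e0 /(_ e)[]]; first by rewrite e0 lexx.
move=> W hW pW; have [T [Ttree TW TL]] := network_tree nrm_norm hW.
have /smt : is_Steiner_tree [fset p i | i in I]%fset T.
  by split => //; apply/fsubsetP => _ /imfsetP[i _ ->]; rewrite TW pW.
rewrite star_length => /le_trans/(_ TL).
have -> : \sum_(i in [set: I]%SET) nrm (p i - p0) = \sum_i nrm (p i - p0).
  by apply: eq_bigl => i; rewrite inE.
by rewrite lerDr pmulr_rge0 // lfunE.
Qed.

(** The competing tree is rooted at [p k]. The bracketing it prescribes has a member [psi = - phi]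
    with [phi] norming [p k - p0], so [psi (p k - p0) = - nrm (p k - p0)] supplies the missing term
    of the star length. *)
Lemma zero_in_sums_SMT_star k : (exists i, i != k) ->
  (forall C, parenthesization nrm Sigma [set i | i != k]%SET C ->
    minkowski_sum C (norming nrm (p k - p0)) 0) ->
  is_SMT nrm [fset p i | i in I]%fset (star p0 [fset p i | i in I]%fset).
Proof.
move=> [j jk] hC; split.
  split; last exact: fsubsetU1.
  apply: star_tree; apply/imfsetP => -[i _ h].
  by have := p_neq_p0 i; rewrite h eqxx.
move=> T [Ttree /fsubsetP NT].
have pT i : p i \in verts T by apply: NT; exact: in_imfset.
have [||C hP h] := @parenthesization_length_bound _ _ _ [set i | i != k]%SET
    (tree_network nrm_norm Ttree (pT k)).
- by apply/set0Pn; exists j; rewrite inE.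
- by move=> i _; exact: pT.
have [psi Cpsi [phi [_ hphi] psiphi]] := hC _ hP.
rewrite star_length (bigD1 k) //= -hphi.
have := h _ Cpsi; have -> : psi = - phi by apply/eqP; rewrite -addr_eq0 psiphi.
have -> : \sum_(i in [set i | i != k]%SET) nrm (p i - p0) = \sum_(i | i != k) nrm (p i - p0).
  by apply: eq_bigl => i; rewrite inE.
by rewrite lfunE /=; lra.
Qed.

End Parenthesizations.

(* k = m.+1, and ord_max is the index of the last point p_k *)
Theorem theorem16 (R : realType) (n : nat) (nrm : 'rV[R]_n -> R)
    (nrm_norm : is_norm nrm)
    (m : nat) (k_ge2 : (2 <= m.+1)%N)
    (p : 'I_m.+1 -> 'rV[R]_n) (p_inj : injective p)
    (p0 : 'rV[R]_n) (p0N : p0 \notin [fset p i | i in 'I_m.+1]%fset) :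
  let N := [fset p i | i in 'I_m.+1]%fset in
  let Sigma := fun i : 'I_m.+1 => norming nrm (p i - p0) in
  let star_is_SMT := is_SMT nrm N (star p0 N) in
  let zero_in_all_reduced :=
    forall C : set (dual R n),
      parenthesization nrm Sigma [set: 'I_m.+1]%SET C -> C 0 in
  let zero_in_all_sums :=
    forall C : set (dual R n),
      parenthesization nrm Sigma [set i : 'I_m.+1 | i != ord_max]%SET C ->
      minkowski_sum C (norming nrm (p ord_max - p0)) 0 in
  (star_is_SMT <-> zero_in_all_reduced) /\
  (zero_in_all_reduced <-> zero_in_all_sums).
Proof.
have p_neq_p0 i : p i != p0 by apply: contraNneq p0N => <-; exact: in_imfset.
have [j jk] : exists i : 'I_m.+1, i != ord_max.
  by exists ord0; rewrite -val_eqE /= neq_ltn (_ : 0 < m)%N.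
move=> N Sigma star_is_SMT zero_red zero_sums.
have smt_red : star_is_SMT -> zero_red.
  by move=> smt C; exact: SMT_star_zero_in.
have red_sums : zero_red -> zero_sums.
  move=> h C hC.
  have dis : ([set i | i != ord_max] :&: [set ord_max])%SET = finset.set0 :> {set 'I_m.+1}.
    by apply/setP => i; rewrite !inE; case: eqP.
  (* [C] and the last term bracket the whole family; forgetting the norm bound leaves the ordinary
     sum. *)
  have := ParSum dis hC (ParSingle _ Sigma ord_max).
  have -> : ([set i | i != ord_max] :|: [set ord_max])%SET = [set: 'I_m.+1]%SET.
    by apply/setP => i; rewrite !inE; case: eqP.
  by move=> /h [].
have sums_smt : zero_sums -> star_is_SMT.
  by apply: zero_in_sums_SMT_star => //; exists j.
by split; [split=> // /red_sums/sums_smt | split=> // /sums_smt/smt_red].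
Qed.
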